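(* Let $\pi_n$ be a polygon with $n$ (unlabelled) vertices. As $n\to\infty$: (1) the minimal size of a family of edges $E$ on $\pi_n$ realizing all triangulations satisfies $|E|=O(n^2)$ and, for every $\varepsilon>0$, $|E|=\Omega(n^{2-\varepsilon})$ (the implied constant depending only on $\varepsilon$); (2) the minimal size of a family of edges $E$ on $\pi_n$ realizing all types of triangles satisfies $|E|=O(n^{4/3}\log^{2/3}n)$ and $|E|=\Omega(n^{4/3})$.
   Context: $\pi_n$ is the $n$-sided polygon, considered up to homeomorphisms, which are allowed to rotate the vertices (i.e. the vertices are unlabelled). An edge on $\pi_n$ is a simple arc in $\pi_n$ connecting two distinct vertices, considered up to isotopy (equivalently a diagonal or a side of the polygon). A triangle in $\pi_n$ has its endpoints at three distinct vertices of $\pi_n$ and is bounded by three edges; its type, i.e. its homeomorphism class, is determined by the triple $(k_1,k_2,k_3)$ of numbers of vertices of $\pi_n$ contained in the three components of $\pi_n\setminus T$ (so $k_1+k_2+k_3=n-3$, with $k_i\ge 0$). A triangulation of $\pi_n$ is a maximal set of interior-disjoint triangles in $\pi_n$; its type is its homeomorphism class. A family of edges $E$ realizes all types of triangles if for every type of triangle there are three edges in $E$ bounding a triangle of that type. It realizes all triangulations if for every triangulation of $\pi_n$ there is a homeomorphism of $\pi_n$ (allowed to rotate the vertices) sending the set of edges of the triangulation to a subset of $E$. *)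

(* Defs.v *)
From mathcomp Require Import all_boot all_fingroup.

Set Implicit Arguments.
Unset Strict Implicit.
Unset Printing Implicit Defensive.

Local Open Scope nat_scope.

(* The vertices of the n-gon are the elements of 'I_n, in this cyclic order.
   An edge (isotopy class of arcs) is determined by its set of endpoints, and a
   triangle by its set of corners. *)
Definition edges (n : nat) : {set {set 'I_n}} := [set e : {set 'I_n} | #|e| == 2].

Definition triangles (n : nat) : {set {set 'I_n}} :=
  [set t : {set 'I_n} | #|t| == 3].

Definition sides (n : nat) : {set {set 'I_n}} :=
  [set [set i; ordS i] | i : 'I_n].

(* Up to isotopy, a homeomorphism of the polygon is the permutation that it
   induces on the vertices, and those that occur are the ones mapping sides to
   sides: for n >= 3 this is the dihedral group (rotations and reflections). *)
Definition polygon_homeo (n : nat) (s : {perm 'I_n}) : bool :=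
  [set s @: e | e : {set 'I_n} in sides n] == sides n.

Definition triangle_edges (n : nat) (t : {set 'I_n}) : {set {set 'I_n}} :=
  [set e in edges n | e \subset t].

(* Two edges have no representatives with disjoint interiors exactly when their
   endpoints are four distinct vertices that alternate around the polygon. *)
Definition crossing (n : nat) (e f : {set 'I_n}) : bool :=
  [exists a : 'I_n, exists b : 'I_n, exists c : 'I_n, exists d : 'I_n,
    [&& a < b, b < c, c < d &
        (e == [set a; c]) && (f == [set b; d])
        || (e == [set b; d]) && (f == [set a; c])]].

(* Meant for distinct triangles t and u: if no edge of t crosses an edge of u,
   then all corners of u lie on one closed side of t, so the open triangles are
   disjoint; and near a crossing point the open triangles do meet. *)
Definition interior_disjoint (n : nat) (t u : {set 'I_n}) : bool :=
  [forall e in triangle_edges t, forall f in triangle_edges u, ~~ crossing e f].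

Definition disjoint_triangles (n : nat) (S : {set {set 'I_n}}) : bool :=
  (S \subset triangles n) &&
  [forall t in S, forall u in S, (t != u) ==> interior_disjoint t u].

Definition triangulation (n : nat) (S : {set {set 'I_n}}) : bool :=
  maxset (@disjoint_triangles n) S.

Definition triangulation_edges (n : nat) (S : {set {set 'I_n}}) :
    {set {set 'I_n}} :=
  \bigcup_(t in S) triangle_edges t.

(* Two triangles have the same type when a homeomorphism maps one to the other. *)
Definition same_type (n : nat) (t u : {set 'I_n}) : bool :=
  [exists s : {perm 'I_n}, polygon_homeo s && (u == s @: t)].

Definition realizes_triangle_types (n : nat) (E : {set {set 'I_n}}) : bool :=
  [forall t in triangles n, exists u in triangles n,
    same_type t u && (triangle_edges u \subset E)].

Definition realizes_triangulations (n : nat) (E : {set {set 'I_n}}) : bool :=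
  [forall S : {set {set 'I_n}}, triangulation S ==>
    [exists s : {perm 'I_n}, polygon_homeo s &&
      ([set s @: e | e : {set 'I_n} in triangulation_edges S] \subset E)]].

(* The minimum is meaningful when P holds of the family of all edges, as it does
   for both properties above. *)
Definition min_family_size (n : nat) (P : pred {set {set 'I_n}}) : nat :=
  #|[arg min_(E < edges n | (E \subset edges n) && P E) #|E|]|.

Lemma polygon_homeo1 (n : nat) : polygon_homeo (1%g : {perm 'I_n}).
Proof.
apply/eqP; rewrite -[RHS]imset_id; apply: eq_imset => e.
by rewrite -[RHS]imset_id; apply: eq_imset => i; rewrite perm1.
Qed.

Lemma edges_realize_triangle_types (n : nat) :
  realizes_triangle_types (edges n).
Proof.
apply/forall_inP => t tT; apply/exists_inP; exists t => //; apply/andP; split.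
  apply/existsP; exists 1%g; rewrite polygon_homeo1; apply/eqP.
  by rewrite -[LHS]imset_id; apply: eq_imset => i; rewrite perm1.
by apply/subsetP => e; rewrite inE => /andP[].
Qed.

Lemma edges_realize_triangulations (n : nat) :
  realizes_triangulations (edges n).
Proof.
apply/forallP => S; apply/implyP => _; apply/existsP; exists 1%g.
rewrite polygon_homeo1; apply/subsetP => _ /imsetP[e /bigcupP[t _ te] ->].
rewrite inE card_imset; last exact: perm_inj.
by move: te; rewrite !inE => /andP[].
Qed.

Definition min_triangulations (n : nat) : nat :=
  min_family_size (@realizes_triangulations n).

Definition min_triangle_types (n : nat) : nat :=
  min_family_size (@realizes_triangle_types n).

(* Main.v *)
(* Lower bounds. At most 2n homeomorphisms act on the n-gon. Place j disjoint
   triangles in j consecutive blocks of about n / j vertices, so that about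
   n^(2j) choices of j pairwise non-crossing edges extend to triangulations. If E
   realizes all of them, each choice is the image of a j-tuple of edges of E under
   a homeomorphism, so n^(2j) <= C n |E|^j and |E| >= c n^(2 - 1/j). For triangle
   types, C(n, 3) triangles fall into orbits of size at most 2n, each of which
   meets E, while |E| edges span at most (2|E|)^(3/2) triangles.

   Upper bounds. All edges realize all triangulations. For triangle types take
   the complete graph on the integers below 2m^3 having a zero among their three
   lowest digits in base m, reduced mod n, where n <= m^3 <= 8n: any three
   vertices can be rotated into this set of O(n^(2/3)) vertices. This even saves
   the logarithmic factor. *)

Require Import Defs.
From mathcomp Require Import all_boot all_fingroup zify.

Set Implicit Arguments.
Unset Strict Implicit.
Unset Printing Implicit Defensive.

Local Open Scope nat_scope.

(** * Attaining and bounding the minimal family size *)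

Lemma min_family_sizeP (n : nat) (P : pred {set {set 'I_n}}) :
  P (edges n) ->
  exists2 E : {set {set 'I_n}}, (E \subset edges n) && P E &
    min_family_size P = #|E|.
Proof.
move=> PE; rewrite /min_family_size.
by case: arg_minnP => [|E PE' _]; [rewrite subxx | exists E].
Qed.

Lemma min_family_size_le (n : nat) (P : pred {set {set 'I_n}})
    (E : {set {set 'I_n}}) :
  P (edges n) -> E \subset edges n -> P E -> min_family_size P <= #|E|.
Proof.
move=> PE sE PE'; rewrite /min_family_size.
by case: arg_minnP => [|F _ ->//]; rewrite ?subxx ?sE.
Qed.

(** * The homeomorphisms of the polygon number at most 2n *)

Definition homeos (n : nat) : {set {perm 'I_n}} := [set s | polygon_homeo s].

Lemma val_iter_ordS (n k : nat) (i : 'I_n) :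
  iter k (@ordS n) i = (i + k) %% n :> nat.
Proof.
elim: k => [|k IH] /=; first by rewrite addn0 modn_small.
by rewrite IH -addn1 modnDml addn1 addnS.
Qed.

Lemma ordS_neq (n : nat) (i : 'I_n) : 1 < n -> ordS i != i.
Proof.
move=> n1; apply/eqP => /(congr1 val) /=; have := ltn_ord i.
have [in1|] := ltnP i.+1 n; first by rewrite modn_small //; lia.
move=> h1 h2; have -> : i.+1 = n by lia.
by rewrite modnn; lia.
Qed.

Lemma ordSS_neq (n : nat) (i : 'I_n) : 2 < n -> ordS (ordS i) != i.
Proof.
move=> n1; rewrite -[ordS (ordS i)]/(iter 2 (@ordS n) i).
apply/eqP => /(congr1 val); rewrite /= -[(i.+1 %% n).+1]addn1 modnDml addn1.
have := ltn_ord i.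
have [in1|] := ltnP i.+2 n; first by rewrite modn_small //; lia.
move=> h1 h2; have -> : i.+2 = n + (i.+2 - n) by lia.
by rewrite modnDl modn_small; lia.
Qed.

(** The side joining [i] to its successor goes to a side through [s i], and only two sides meet
    there. *)
Lemma homeo_step (n : nat) (s : {perm 'I_n}) (i : 'I_n) : 2 < n ->
  polygon_homeo s -> s (ordS i) = ordS (s i) \/ s (ordS i) = ord_pred (s i).
Proof.
move=> n2 /eqP hs.
have : [set s i; s (ordS i)] \in sides n.
  rewrite -hs; apply/imsetP; exists [set i; ordS i]; first exact: imset_f.
  by rewrite imsetU1 imset_set1.
case/imsetP=> k _ e.
have ni : s (ordS i) != s i by rewrite (inj_eq perm_inj) ordS_neq //; lia.
have := set21 (s i) (s (ordS i)); rewrite e !inE => /orP[]/eqP ei.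
  have := set22 (s i) (s (ordS i)); rewrite e !inE => /orP[]/eqP ej.
    by rewrite ej ei eqxx in ni.
  by left; rewrite ei.
have := set22 (s i) (s (ordS i)); rewrite e !inE => /orP[]/eqP ej.
  by right; rewrite ei ordSK.
by rewrite ej ei eqxx in ni.
Qed.

(** The first step fixes the direction for good: turning back would give two vertices at distance
    two the same image, and these are distinct once [2 < n]. *)
Lemma homeo_iter (n : nat) (s : {perm 'I_n}) (i : 'I_n) : 2 < n ->
  polygon_homeo s ->
  let f := if s (ordS i) == ordS (s i) then @ordS n else @ord_pred n in
  forall k, s (iter k (@ordS n) i) = iter k f (s i).
Proof.
move=> n2 hs f k.
have hstep : s (ordS i) = f (s i).
  rewrite /f; case: eqP => // h.
  by case: (homeo_step i n2 hs).
(* The induction carries two consecutive images, since both are needed to exclude a turn. *)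
suff : s (iter k (@ordS n) i) = iter k f (s i) /\
    s (iter k.+1 (@ordS n) i) = f (iter k f (s i)) by case.
elim: k => [//|k [IH1 IH2]].
split=> [//|]; rewrite [in RHS]iterS -IH2.
set j := iter k (@ordS n) i in IH1 IH2 *.
rewrite -IH1 in IH2.
have ne : s (ordS (ordS j)) != s j by rewrite (inj_eq perm_inj) ordSS_neq.
rewrite [LHS]/= -/j [iter k.+1 _ _]/= -/j.
move: IH2; rewrite /= -/j /f; case: (s (ordS i) == _) => IH2;
  case: (homeo_step (ordS j) n2 hs) => // h; move: ne.
  by rewrite h IH2 ordSK eqxx.
by rewrite h IH2 ord_predK eqxx.
Qed.

Lemma card_homeos (n : nat) : 2 < n -> #|homeos n| <= n.*2.
Proof.
move=> n2; have n0 : 0 < n by lia.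
pose i0 := Ordinal n0.
(* A homeomorphism is determined by the image of vertex 0 and its direction. *)
pose code (s : {perm 'I_n}) := (s i0, s (ordS i0) == ordS (s i0)).
have inj : {in homeos n &, injective code}.
  move=> s u; rewrite !inE => hs hu [e1 e2]; apply/permP => i.
  have -> : i = iter i (@ordS n) i0.
    by apply: val_inj; rewrite /= val_iter_ordS add0n modn_small.
  by rewrite (homeo_iter i0 n2 hs) (homeo_iter i0 n2 hu) /= e2 e1.
rewrite -(card_in_imset inj) (leq_trans (max_card _)) //.
by rewrite card_prod card_ord card_bool muln2.
Qed.

Lemma homeo_inv (n : nat) (s : {perm 'I_n}) (e f : {set 'I_n}) :
  s @: e = f -> e = s^-1%g @: f.
Proof.
move=> <-; rewrite -imset_comp -[LHS]imset_id.
by apply: eq_imset => i /=; rewrite permK.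
Qed.

(** * Triangles spanned by few edges, and the lower bound for triangle types *)

Lemma leq_sqr_sum (I : finType) (A : {set I}) (f : I -> nat) :
  (\sum_(i in A) f i) ^ 2 <= #|A| * \sum_(i in A) f i ^ 2.
Proof.
rewrite -(leq_pmul2l (m := 2)) // -mulnn big_distrlr /= big_distrr /=.
have -> : 2 * (#|A| * \sum_(i in A) f i ^ 2) =
    \sum_(i in A) \sum_(j in A) (f i ^ 2 + f j ^ 2).
  under [RHS]eq_bigr => i _ do rewrite big_split sum_nat_const /=.
  by rewrite big_split sum_nat_const /= -big_distrr addnn mul2n.
apply: leq_sum => i _; rewrite big_distrr /=; apply: leq_sum => j _.
exact: nat_Cauchy.
Qed.

Lemma sum_card_dep (I J : finType) (A : {set I}) (B : I -> {set J}) :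
  \sum_(i in A) #|B i| = #|[set p | (p.1 \in A) && (p.2 \in B p.1)]|.
Proof.
under eq_bigr do rewrite -sum1_card.
by rewrite pair_big_dep /= sum1dep_card.
Qed.

(* Cauchy-Schwarz over the arcs xy; a pair of triangles xyz, xyw on the same arc
   is determined by the two arcs xz and yw. *)
Lemma card_transitive_triples (T : finType) (r : rel T) :
  #|[set t : T * T * T | [&& r t.1.1 t.1.2, r t.1.1 t.2 & r t.1.2 t.2]]| ^ 2
    <= #|[set p : T * T | r p.1 p.2]| ^ 3.
Proof.
set A := [set p : T * T | r p.1 p.2].
pose B (p : T * T) := [set z | r p.1 z && r p.2 z].
have -> : #|[set t : T * T * T | [&& r t.1.1 t.1.2, r t.1.1 t.2 & r t.1.2 t.2]]|
    = \sum_(p in A) #|B p|.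
  by rewrite sum_card_dep; apply: eq_card => t; rewrite !inE.
apply: leq_trans (leq_sqr_sum _ _) _; rewrite (expnS _ 2) leq_mul2l; apply/orP; right.
under eq_bigr do rewrite -mulnn -cardsX.
rewrite sum_card_dep -mulnn -cardsX.
pose g (q : (T * T) * (T * T)) := ((q.1.1, q.2.1), (q.1.2, q.2.2)).
have g_inj : injective g by case=> [[? ?] [? ?]] [[? ?] [? ?]] [-> -> -> ->].
rewrite -(card_imset _ g_inj); apply/subset_leq_card/subsetP => _ /imsetP[q + ->].
by rewrite !inE /= => /and3P[_ /andP[-> _] /andP[_ ->]].
Qed.

Lemma card_arcs_le (n : nat) (E : {set {set 'I_n}}) : E \subset edges n ->
  #|[set p : 'I_n * 'I_n | [set p.1; p.2] \in E]| <= #|E|.*2.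
Proof.
move=> sE; rewrite -muln2 -card_bool -[#|E| * _]/(#|E| * #|{: bool}|) -cardsT -cardsX.
(* The boolean tells apart the two orderings of an edge. *)
pose f (p : 'I_n * 'I_n) := ([set p.1; p.2], p.1 < p.2).
have f_inj : {in [set p : 'I_n * 'I_n | [set p.1; p.2] \in E] &, injective f}.
  move=> [a b] [c d]; rewrite !inE /= => abE cdE [e lt].
  have /subsetP/(_ _ abE) := sE; rewrite inE cards2 => /eqP/eqP; rewrite eqSS eqb1 => ab.
  have /subsetP/(_ _ cdE) := sE; rewrite inE cards2 => /eqP/eqP; rewrite eqSS eqb1 => cd.
  have := set21 a b; have := set22 a b; rewrite e !inE.
  move=> /orP[]/eqP eb /orP[]/eqP ea; subst => //; rewrite ?eqxx // in ab cd *.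
  by move: lt ab => /=; rewrite -(inj_eq val_inj) /=; lia.
rewrite -(card_in_imset f_inj); apply/subset_leq_card/subsetP => _ /imsetP[p + ->].
by rewrite !inE /= => ->.
Qed.

Lemma cards3 (T : finType) (A : {set T}) : #|A| = 3 ->
  exists x y z, [/\ x != y, x != z, y != z & A = [set x; y; z]].
Proof.
move=> A3; have /card_gt0P[x xA] : 0 < #|A| by rewrite A3.
have : #|A :\ x| == 2 by apply/eqP; have := cardsD1 x A; rewrite A3 xA add1n => -[].
case/cards2P=> y [z [yz e]].
have := set21 y z; have := set22 y z; rewrite -e !inE => /andP[zx zA] /andP[yx yA].
exists x, y, z; split; rewrite // 1?eq_sym //.
by rewrite -setUA -e setD1K.
Qed.

Definition triangles_of (n : nat) (E : {set {set 'I_n}}) : {set {set 'I_n}} :=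
  [set t in triangles n | triangle_edges t \subset E].

(** Any ordering of the corners turns a triangle into a triple counted by [card_transitive_triples];
    the factor 2 comes from orienting the edges. *)
Lemma card_triangles_of (n : nat) (E : {set {set 'I_n}}) : E \subset edges n ->
  #|triangles_of E| ^ 2 <= #|E|.*2 ^ 3.
Proof.
move=> sE; pose r := [rel x y : 'I_n | [set x; y] \in E].
apply: leq_trans (leq_trans (card_transitive_triples r) _); last first.
  by rewrite leq_exp2r // card_arcs_le.
rewrite leq_exp2r //.
apply: leq_trans (leq_imset_card (fun t => [set t.1.1; t.1.2; t.2]) _).
apply/subset_leq_card/subsetP => u; rewrite !inE => /andP[/eqP /cards3].
move=> [x [y [z [xy xz yz ->]]]] /subsetP sub.
have mem a b : a != b -> [set a; b] \subset [set x; y; z] -> [set a; b] \in E.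
  by move=> ab s; apply: sub; rewrite !inE s cards2 ab.
apply/imsetP; exists (x, y, z) => //=; rewrite !inE /=.
by rewrite !mem //; apply/subsetP => w; rewrite !inE => /orP[] ->; rewrite ?orbT.
Qed.

(** Every triangle is pulled back by a homeomorphism from one spanned by [E]. Squaring keeps the
    exponent 3/2 of the triangle count integral. *)
Lemma triangle_types_lower (n : nat) (E : {set {set 'I_n}}) : 2 < n ->
  E \subset edges n -> realizes_triangle_types E ->
  'C(n, 3) ^ 2 <= n.*2 ^ 2 * #|E|.*2 ^ 3.
Proof.
move=> n2 sE rE; apply: leq_trans (leq_mul _ (card_triangles_of sE)); last first.
  exact: leqnn.
rewrite -expnMn leq_exp2r // -{1}(card_ord n) -card_draws.
apply: leq_trans (leq_mul (card_homeos n2) (leqnn _)); rewrite -cardsX.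
apply: leq_trans (leq_imset_card
  (fun p : {perm 'I_n} * {set 'I_n} => p.1^-1%g @: p.2) _).
apply/subset_leq_card/subsetP => t tT.
have /exists_inP[u uT /andP[/existsP[s /andP[hs /eqP us]] uE]] := forall_inP rE t tT.
apply/imsetP; exists (s, u); first by rewrite !inE /= hs uE andbT; move: uT; rewrite inE.
exact: homeo_inv.
Qed.

(** * A small set into which any three vertices can be rotated *)

Lemma add_to_multiple (m c : nat) : 0 < m -> exists2 d, d < m & m %| d + c.
Proof.
move=> m0; exists ((m - c %% m) %% m); first by rewrite ltn_mod.
rewrite /dvdn modnDml -modnDmr subnK ?modnn //.
exact/ltnW/ltn_pmod.
Qed.

(* With digits in base [m], the lowest digit of [x] vanishes, its next one is
   chosen so that the middle digit of [x + a] vanishes, and its highest one so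
   that the highest digit of [x + b] vanishes. *)
Lemma digit_shift (m a b : nat) : 0 < m -> a < m ^ 3 -> b < m ^ 3 ->
  exists x1 x2 q r q' r', let x := x1 * m + x2 * m ^ 2 in
    [/\ [/\ x1 < m & x2 < m], [/\ q < m.*2, r < m & x + a = q * m ^ 2 + r] &
        [/\ q' < 2, r' < m ^ 2 & x + b = q' * m ^ 3 + r']].
Proof.
move=> m0 am bm.
have [x1 x1m /dvdnP[k1 e1]] := add_to_multiple (a %/ m) m0.
have [x2 x2m /dvdnP[k2 e2]] := add_to_multiple ((x1 * m + b) %/ m ^ 2) m0.
have ea := divn_eq a m; have eb := divn_eq (x1 * m + b) (m ^ 2).
have ra : a %% m < m by rewrite ltn_mod.
have rb : (x1 * m + b) %% m ^ 2 < m ^ 2 by rewrite ltn_mod expn_gt0 m0.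
(* Hence [x + a] and [x + b] are below [2 * m ^ 3], which yields the bounds on [q] and [q']. *)
have xm : x1 * m + x2 * m ^ 2 < m ^ 3 by nia.
exists x1, x2, (x2 + k1), (a %% m), k2, ((x1 * m + b) %% m ^ 2) => x.
have Ea : x + a = (x2 + k1) * m ^ 2 + a %% m by rewrite /x; nia.
have Eb : x + b = k2 * m ^ 3 + (x1 * m + b) %% m ^ 2 by rewrite /x; nia.
split; first by [].
  split=> //; rewrite -(ltn_pmul2r (m := m ^ 2)) ?expn_gt0 ?m0 //.
  by rewrite -muln2 -mulnA mulnCA -expnS; lia.
by split=> //; rewrite -(ltn_pmul2r (m := m ^ 3)) ?expn_gt0 ?m0 //; lia.
Qed.

Definition rotation (n k : nat) : {perm 'I_n} := (perm (@ordS_inj n) ^+ k)%g.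

Lemma rotationE (n k : nat) (i : 'I_n) : rotation n k i = (i + k) %% n :> nat.
Proof.
rewrite /rotation permX -val_iter_ordS; congr (nat_of_ord _).
by apply: eq_iter => j; rewrite permE.
Qed.

Lemma rotation_homeo (n k : nat) : polygon_homeo (rotation n k).
Proof.
rewrite /polygon_homeo eqEcard (card_imset _ (imset_inj perm_inj)) leqnn andbT.
apply/subsetP => _ /imsetP[_ /imsetP[i _ ->] ->].
rewrite imsetU1 imset_set1; have -> : rotation n k (ordS i) = ordS (rotation n k i).
  by apply: val_inj; rewrite /= !rotationE /= modnDml -[in RHS]addn1 modnDml addn1 addSn.
exact: imset_f.
Qed.

Definition complete_edges (n : nat) (A : {set 'I_n}) : {set {set 'I_n}} :=
  [set e in edges n | e \subset A].

Lemma card_complete_edges (n : nat) (A : {set 'I_n}) :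
  #|complete_edges A| <= #|A| ^ 2.
Proof.
rewrite -mulnn -cardsX.
apply: leq_trans (leq_imset_card (fun p : 'I_n * 'I_n => [set p.1; p.2]) _).
apply/subset_leq_card/subsetP => e; rewrite !inE => /andP[/cards2P[x [y [_ ->]]]].
rewrite subUset !sub1set => /andP[xA yA].
by apply/imsetP; exists (x, y); rewrite // inE /= xA.
Qed.

Lemma complete_edges_realize (n : nat) (A : {set 'I_n}) :
  (forall i j k : 'I_n, exists c, [/\ rotation n c i \in A, rotation n c j \in A &
     rotation n c k \in A]) ->
  realizes_triangle_types (complete_edges A).
Proof.
move=> hA; apply/forall_inP => t tT.
have /cards3[x [y [z [_ _ _ et]]]] : #|t| = 3 by move: tT; rewrite inE => /eqP.
have [c [xA yA zA]] := hA x y z.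
apply/exists_inP; exists (rotation n c @: t).
  by rewrite inE card_imset ?inE //; [move: tT; rewrite inE | apply: perm_inj].
apply/andP; split.
  by apply/existsP; exists (rotation n c); rewrite rotation_homeo eqxx.
apply/subsetP => e; rewrite !inE => /andP[-> /subset_trans -> //].
apply/subsetP => _ /imsetP[v + ->]; rewrite et !inE.
by case/orP => [/orP[]|] /eqP ->.
Qed.

Lemma rotating_set (n m : nat) : 0 < n -> n <= m ^ 3 ->
  exists2 A : {set 'I_n}, #|A| <= 5 * m ^ 2 &
  forall i j k : 'I_n, exists c, [/\ rotation n c i \in A, rotation n c j \in A &
     rotation n c k \in A].
Proof.
move=> n0 nm.
have m0 : 0 < m by case: m nm n0 => //; case: n.
pose pt y := Ordinal (ltn_pmod y n0).
(* [A0], [A1] and [A2] collect residues of numbers whose lowest, middle and highest of the three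
   lowest base [m] digits vanishes; the sizes are at most [m ^ 2], [2 * m ^ 2] and [2 * m ^ 2]. *)
pose A0 := [set pt (p.1 * m + p.2 * m ^ 2) | p : 'I_m * 'I_m].
pose A1 := [set pt (p.1 * m ^ 2 + p.2) | p : 'I_(m.*2) * 'I_m].
pose A2 := [set pt (p.1 * m ^ 3 + p.2) | p : 'I_2 * 'I_(m ^ 2)].
exists (A0 :|: A1 :|: A2) => [|i j k].
  have h0 : #|A0| <= m * m.
    by rewrite (leq_trans (leq_imset_card _ _)) // card_prod !card_ord.
  have h1 : #|A1| <= m.*2 * m.
    by rewrite (leq_trans (leq_imset_card _ _)) // card_prod !card_ord.
  have h2 : #|A2| <= 2 * m ^ 2.
    by rewrite (leq_trans (leq_imset_card _ _)) // card_prod !card_ord.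
  apply: leq_trans (leq_card_setU _ _) _.
  apply: leq_trans (leq_add (leq_trans (leq_card_setU _ _) (leq_add h0 h1)) h2) _.
  by clear; nia.
(* The positions of [j] and [k] once [i] is rotated to 0. *)
pose a := (j + (n - i)) %% n; pose b := (k + (n - i)) %% n.
have am : a < m ^ 3 by apply: leq_trans nm; rewrite ltn_mod.
have bm : b < m ^ 3 by apply: leq_trans nm; rewrite ltn_mod.
have [x1 [x2 [q [r [q' [r' /= [[h1 h2] [h3 h4 ea] [h5 h6 eb]]]]]]]] :=
  digit_shift m0 am bm.
set x := (x1 * m + x2 * m ^ 2) in ea eb.
(* Rotate [i] to 0, then shift by [x]: the three vertices land in [A0], [A1] and [A2]
   respectively. *)
exists (n - i + x); rewrite !inE; split.
- apply/orP; left; apply/orP; left; apply/imsetP; exists (Ordinal h1, Ordinal h2) => //.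
  apply: val_inj; rewrite /= rotationE addnA subnKC; last exact/ltnW.
  by rewrite modnDl.
- apply/orP; left; apply/orP; right; apply/imsetP; exists (Ordinal h3, Ordinal h4) => //.
  by apply: val_inj; rewrite /= rotationE -ea addnA -modnDml addnC.
- apply/orP; right; apply/imsetP; exists (Ordinal h5, Ordinal h6) => //.
  by apply: val_inj; rewrite /= rotationE -eb addnA -modnDml addnC.
Qed.

Lemma triangle_types_upper (n m : nat) : 0 < n -> n <= m ^ 3 ->
  min_triangle_types n <= 25 * m ^ 4.
Proof.
move=> n0 nm; have [A cA hA] := rotating_set n0 nm.
apply: leq_trans (min_family_size_le (edges_realize_triangle_types n) _
  (complete_edges_realize hA)) _.
  by apply/subsetP => e; rewrite inE => /andP[].
apply: leq_trans (card_complete_edges A) _.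
by rewrite -[25]/(5 ^ 2) -[4]/(2 * 2) expnM -expnMn leq_exp2r.
Qed.

(** * Independent triangles in blocks, and the lower bound for triangulations *)

(** The block index is monotone, so an endpoint lying between two vertices of one block belongs to
    that block. *)
Lemma crossing_blocks (n B i j : nat) (e f : {set 'I_n}) :
  crossing e f -> {in e, forall v : 'I_n, v %/ B = i} ->
  {in f, forall v : 'I_n, v %/ B = j} -> i = j.
Proof.
move=> /existsP[a /existsP[b /existsP[c /existsP[d /and4P[ab bc cd ef]]]]] he hf.
have mono (u v : 'I_n) : u < v -> u %/ B <= v %/ B by move/ltnW; apply: leq_div2r.
have lab := mono _ _ ab; have lbc := mono _ _ bc; have lcd := mono _ _ cd.
case/orP: ef => /andP[/eqP ee /eqP ff]; subst e f.
  have := he a (set21 _ _); have := he c (set22 _ _).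
  by have := hf b (set21 _ _); have := hf d (set22 _ _); lia.
have := he b (set21 _ _); have := he d (set22 _ _).
by have := hf a (set21 _ _); have := hf c (set22 _ _); lia.
Qed.

(** Triangles in different blocks do not cross, so together they form a disjoint family, which lies
    in a maximal one. *)
Lemma triangulation_extend (n j B : nat) (t : 'I_j -> {set 'I_n}) :
  (forall i, #|t i| = 3) -> (forall i, {in t i, forall v : 'I_n, v %/ B = i}) ->
  exists2 S, triangulation S &
    forall i e, e \in edges n -> e \subset t i -> e \in triangulation_edges S.
Proof.
move=> t3 tB.
have D : disjoint_triangles [set t i | i : 'I_j].
  apply/andP; split; first by apply/subsetP => _ /imsetP[i _ ->]; rewrite inE t3.
  apply/forall_inP => _ /imsetP[i _ ->]; apply/forall_inP => _ /imsetP[i' _ ->].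
  apply/implyP => ne; apply/forall_inP => e; rewrite inE => /andP[_ /subsetP he].
  apply/forall_inP => f; rewrite inE => /andP[_ /subsetP hf].
  apply: contraNN ne => cef; suff -> : i = i' by [].
  apply: val_inj; apply: (@crossing_blocks n B _ _ e f cef) => v.
    by move/he; apply: tB.
  by move/hf; apply: tB.
have [S mS sub] := maxset_exists D.
exists S => // i e eE et; apply/bigcupP; exists (t i); last by rewrite inE eE.
by apply: (subsetP sub); apply: imset_f.
Qed.

(* Each of [j] consecutive blocks of [2 * L + 1] vertices carries a triangle with
   one corner in the left half, the middle vertex, and one corner in the right
   half; the edge opposite to the middle vertex can be chosen in [L ^ 2] ways. *)
Lemma triangulations_lower (n j L : nat) (E : {set {set 'I_n}}) :
  2 < n -> j * L.*2.+1 <= n -> realizes_triangulations E ->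
  L ^ j.*2 <= n.*2 * #|E| ^ j.
Proof.
move=> n2 jL rE; set B := L.*2.+1 in jL.
have n0 : 0 < n by lia.
pose pt y := Ordinal (ltn_pmod y n0).
have ptE (i : 'I_j) k : k < B -> pt (i * B + k) = i * B + k :> nat.
  move=> kB; rewrite /= modn_small //; apply: leq_trans jL.
  by have := ltn_ord i; nia.
pose x (i : 'I_j) (u : 'I_L) := pt (i * B + u).
pose mid (i : 'I_j) := pt (i * B + L).
pose y (i : 'I_j) (w : 'I_L) := pt (i * B + (L + 1 + w)).
have xE i u : x i u = i * B + u :> nat by apply: ptE; rewrite /B; have := ltn_ord u; lia.
have mE i : mid i = i * B + L :> nat by apply: ptE; rewrite /B; lia.
have yE i w : y i w = i * B + (L + 1 + w) :> nat.
  by apply: ptE; rewrite /B; have := ltn_ord w; lia.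
clearbody x mid y.
pose side (i : 'I_j) (p : 'I_L * 'I_L) : {set 'I_n} := [set x i p.1; y i p.2].
have xlty i u w : x i u < y i w by rewrite xE yE; have := ltn_ord u; lia.
have side_inj i : injective (side i).
  move=> [u w] [u' w'] /= e.
  have := set21 (x i u) (y i w); have := set22 (x i u) (y i w).
  rewrite -/(side i (u, w)) e !inE /=.
  have := xE i u; have := yE i w; have := xE i u'; have := yE i w'.
  move: (ltn_ord u) (ltn_ord u') => uL u'L ey' ex' ey ex.
  case/orP=> /eqP e2 /orP[]/eqP e1; rewrite e1 e2 in ex ey; try lia.
  by congr (_, _); apply: val_inj => /=; lia.
(* A choice [c] selects one edge per block; distinct choices give distinct tuples of edges. *)
pose fam (c : {ffun 'I_j -> 'I_L * 'I_L}) := [ffun i => side i (c i)].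
have fam_inj : injective fam.
  move=> c c' /ffunP e; apply/ffunP => i; apply: (side_inj i).
  by have := e i; rewrite !ffunE.
have <- : #|[set fam c | c : {ffun 'I_j -> 'I_L * 'I_L}]| = L ^ j.*2.
  by rewrite (card_imset _ fam_inj) card_ffun card_prod !card_ord mulnn -expnM mul2n.
pose Phi := [set f : {ffun 'I_j -> {set 'I_n}} | f \in ffun_on (mem E)].
have cPhi : #|Phi| = #|E| ^ j by rewrite cardsE card_ffun_on card_ord.
(* Each tuple is recovered from a homeomorphism and a tuple of edges of [E]. One homeomorphism
   serves all [j] edges, so the factor 2n enters only once. *)
rewrite -cPhi; apply: leq_trans (leq_mul (card_homeos n2) (leqnn _)); rewrite -cardsX.
apply: leq_trans (leq_imset_card (fun q : {perm 'I_n} * {ffun 'I_j -> {set 'I_n}} =>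
  [ffun i => q.1^-1%g @: q.2 i]) _).
apply/subset_leq_card/subsetP => _ /imsetP[c _ ->].
pose t (i : 'I_j) : {set 'I_n} := [set x i (c i).1; mid i; y i (c i).2].
have t3 i : #|t i| = 3.
  rewrite /t setUC cardsU1 cards2 !inE -!(inj_eq val_inj) /= xE mE yE.
  by have := ltn_ord (c i).1; do ?[case: eqP => /=]; lia.
have tB i : {in t i, forall v : 'I_n, v %/ B = i}.
  have div k : k < B -> (i * B + k) %/ B = i by move=> kB; rewrite divnMDl // divn_small ?addn0.
  move=> v; rewrite !inE => /orP[/orP[]|] /eqP ->; rewrite ?xE ?mE ?yE div // /B;
    have := ltn_ord (c i).1; have := ltn_ord (c i).2; lia.
have [S tS hS] := triangulation_extend t3 tB.
have /existsP[s /andP[hs /subsetP sE]] := implyP (forallP rE S) tS.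
apply/imsetP; exists (s, [ffun i => s @: side i (c i)]).
  rewrite !inE hs /=; apply/ffun_onP => i; rewrite ffunE; apply: sE; apply: imset_f.
  apply: (hS i); first by rewrite inE cards2 -(inj_eq val_inj) /= neq_ltn xlty.
  by rewrite subUset !sub1set !inE !eqxx !orbT.
by apply/ffunP => i; rewrite !ffunE /= -(homeo_inv (erefl _)).
Qed.

(** * Explicit integer bounds for the two minima *)

Lemma min_triangulations_upper (n : nat) : min_triangulations n <= n ^ 2.
Proof.
apply: leq_trans (min_family_size_le (edges_realize_triangulations n) _
  (edges_realize_triangulations n)) _ => //.
have -> : edges n = complete_edges [set: 'I_n].
  by apply/setP => e; rewrite !inE subsetT andbT.
by rewrite -[n in n ^ 2]card_ord -cardsT card_complete_edges.
Qed.

Lemma min_triangulations_lower (n j : nat) : 0 < j -> 4 * j <= n ->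
  n ^ j.*2.-1 <= (128 * j ^ 2 * min_triangulations n) ^ j.
Proof.
move=> j0 jn.
rewrite /min_triangulations.
have [E /andP[_ rE] ->] := min_family_sizeP (edges_realize_triangulations n).
(* With this [L] the [j] blocks fit into [n] vertices, and since [L] is positive,
   [n < 4 * j * (L + 1) <= 8 * j * L]. *)
set L := n %/ (4 * j).
have L0 : 0 < L by rewrite divn_gt0; lia.
have Ln : L * (4 * j) <= n by apply: leq_divM.
have nL : n <= 8 * j * L.
  by apply/ltnW/(leq_trans (ltn_ceil n (d := 4 * j) _)); rewrite -/L; nia.
have := @triangulations_lower n j L E; rewrite -[L.*2]mul2n.
move=> /(_ _ _ rE) low; have {low} low : L ^ j.*2 <= n.*2 * #|E| ^ j by apply: low; nia.
have n0 : 0 < n by lia.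
rewrite -(leq_pmul2l n0) -expnS prednK ?double_gt0 //.
apply: leq_trans (_ : (8 * j * L) ^ j.*2 <= _); first by rewrite leq_exp2r ?double_gt0.
rewrite expnMn -[j.*2 in X in X * _]mul2n expnM.
apply: leq_trans (leq_mul (leqnn _) low) _.
have -> : 128 * j ^ 2 = 2 * (8 * j) ^ 2 by rewrite expnMn mulnA.
rewrite (expnMn _ #|E|) (expnMn 2) -mul2n.
(* The 2 in [128 = 2 * 8 ^ 2], raised to the power [j], absorbs the 2 of the factor 2n. *)
have : 2 <= 2 ^ j by rewrite -[X in X <= _]expn1 leq_pexp2l.
move: (2 ^ j) (((8 * j) ^ 2) ^ j) (#|E| ^ j) => t A M t2.
by have := leq_mul (leqnn (n * A * M)) t2; lia.
Qed.

Lemma min_triangle_types_lower (n : nat) : 3 < n ->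
  n ^ 4 <= (21 * min_triangle_types n) ^ 3.
Proof.
move=> n3.
rewrite /min_triangle_types.
have [E /andP[sE rE] ->] := min_family_sizeP (edges_realize_triangle_types n).
have := triangle_types_lower (ltnW n3) sE rE.
(* The constant 16 is sharp: equality holds at [n = 4]. *)
have : n ^ 3 <= 16 * 'C(n, 3).
  have := bin_ffact n 3; rewrite ffactnS ffactnSr ffactn1.
  rewrite -[3`!]/6 !(expnS n) expn0 => h.
  have : 3 * (n * n) <= 8 * (n.-1 * n.-2) by case: n n3 {h E sE rE} => [|[|n]] //=; nia.
  rewrite -(leq_pmul2l (m := 2 * n)) => [h'|]; last by lia.
  move: h h'; rewrite -[n.-2]/(n.-1.-1); move: (n.-1) => p; lia.
rewrite -(leq_exp2r _ _ (isT : 0 < 2)) => h1 h2.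
have {h1 h2} h : n ^ 2 * n ^ 4 <= n ^ 2 * (16 ^ 2 * 2 ^ 5 * #|E| ^ 3).
  rewrite -expnD (expnM n 3 2); apply: leq_trans h1 _; rewrite expnMn.
  apply: leq_trans (leq_mul (leqnn _) h2) _.
  by rewrite -!mul2n !expnMn; lia.
have n2 : 0 < n ^ 2 by rewrite expn_gt0; lia.
move: h; rewrite (leq_pmul2l n2) => /leq_trans; apply.
(* Here [16 ^ 2 * 2 ^ 5 = 8192], and 21 is the least integer whose cube reaches it. *)
by rewrite expnMn leq_mul2r; apply/orP; right; lia.
Qed.

(** Take the least [m] with [n <= m ^ 3]: if [m > 1], then [(m - 1) ^ 3 < n] and
    [m <= 2 * (m - 1)]. *)
Lemma cube_ceil (n : nat) : 0 < n -> exists2 m, n <= m ^ 3 & m ^ 3 <= 8 * n.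
Proof.
move=> n0; have ex : exists m, n <= m ^ 3 by exists n; rewrite -{1}(expn1 n) leq_pexp2l.
exists (ex_minn ex); case: ex_minnP => // m nm mmin.
case: m nm mmin => [|m] nm mmin; first by lia.
have [->|m0] := posnP m; first by lia.
have : m ^ 3 < n by rewrite ltnNge; apply/negP => /mmin; lia.
have : m.+1 ^ 3 <= (2 * m) ^ 3 by rewrite leq_exp2r //; lia.
by rewrite expnMn; lia.
Qed.

(* Passage to real asymptotics *)
From HB Require Import structures.
From mathcomp Require Import all_order all_algebra.
From mathcomp Require Import all_classical all_reals all_analysis.
Import Order.TTheory GRing.Theory Num.Theory.
Import numFieldNormedType.Exports.
Local Open Scope classical_set_scope.
Local Open Scope ring_scope.

Lemma eqO_nat (R : realType) (f g : nat -> R) (k : R) (N : nat) : 0 < k ->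
  (forall n : nat, (N <= n)%N -> `|f n| <= k * `|g n|) ->
  (f : nat -> R^o) =O_\oo (g : nat -> R^o).
Proof. by move=> k0 fg; apply/eqO_exP; exists k => //; exists N. Qed.

Lemma eqOmega_nat (R : realType) (f g : nat -> R) (k : R) (N : nat) : 0 < k ->
  (forall n : nat, (N <= n)%N -> `|g n| <= k * `|f n|) ->
  (f : nat -> R^o) =Omega_\oo (g : nat -> R^o).
Proof. by move=> k0 fg; rewrite eqOmegaE eqOmegaO; apply: eqO_nat k0 fg. Qed.

Lemma powR_exp (R : realType) (x r : R) (k : nat) : (x `^ r) ^+ k = x `^ (r * k%:R).
Proof. by rewrite powRrM powR_mulrn // powR_ge0. Qed.

Theorem theorem1p4 (R : realType) :
  ((fun n : nat => (min_triangulations n)%:R : R^o)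
     =O_\oo (fun n : nat => n%:R ^+ 2 : R^o)
   /\ forall eps : R, 0 < eps ->
        (fun n : nat => (min_triangulations n)%:R : R^o)
          =Omega_\oo (fun n : nat => n%:R `^ (2 - eps) : R^o))
  /\ ((fun n : nat => (min_triangle_types n)%:R : R^o)
        =O_\oo (fun n : nat => n%:R `^ (4 / 3) * ln n%:R `^ (2 / 3) : R^o)
      /\ (fun n : nat => (min_triangle_types n)%:R : R^o)
           =Omega_\oo (fun n : nat => n%:R `^ (4 / 3) : R^o)).
Proof.
split; split.
- apply: (@eqO_nat _ _ _ 1 0) => // n _.
  by rewrite mul1r !ger0_norm // -natrX ler_nat min_triangulations_upper.
- move=> eps eps0.
  (* Chosen so that [1 / j <= eps]; after raising to the power [j], the exponent [(2 - eps) * j] is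
     at most [2 * j - 1]. *)
  pose j := (Num.truncn eps^-1).+1.
  have j1 : 1 <= eps * j%:R.
    by rewrite -ler_pdivrMl // mulr1 ltW // truncnS_gt.
  apply: (@eqOmega_nat _ _ _ (128 * j ^ 2)%N%:R (4 * j)) => [|n jn].
    by rewrite ltr0n.
  have n1 : 1 <= n%:R :> R by rewrite ler1n; apply: leq_trans jn.
  rewrite !ger0_norm ?powR_ge0 // -natrM.
  rewrite -(@ler_pXn2r _ j) ?nnegrE ?powR_ge0 // powR_exp -natrX.
  apply: le_trans (_ : n%:R ^+ j.*2.-1 <= _); last first.
    by rewrite -natrX ler_nat min_triangulations_lower.
  rewrite -powR_mulrn ?(le_trans _ n1) // ler_powR // mulrBl.
  by rewrite -subn1 natrB ?double_gt0 // -mul2n natrM lerB.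
- apply: (@eqO_nat _ _ _ (25 * 2 ^+ 4) (Num.truncn (expR 1 : R)).+1) => [|n en].
    by rewrite mulr_gt0 ?exprn_gt0 ?ltr0n.
  have ne : expR 1 <= n%:R :> R.
    by rewrite (le_trans (ltW (truncnS_gt _))) // ler_nat.
  have n0 : (0 < n)%N by apply: leq_trans en.
  have [m nm mn] := cube_ceil n0.
  rewrite !ger0_norm ?mulr_ge0 ?powR_ge0 // mulrA.
  have lnn : 1 <= ln n%:R `^ (2 / 3) :> R.
    apply: le_trans (_ : 1 `^ (2 / 3) <= _); first by rewrite powR1.
    rewrite ge0_ler_powR // ?nnegrE //.
      by rewrite ln_ge0 // ler1n.
    by rewrite -[X in X <= _]expRK ler_ln // posrE ?expR_gt0 // ltr0n.
  apply: le_trans (ler_peMr _ lnn); last first.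
    by rewrite !mulr_ge0 ?exprn_ge0 ?powR_ge0 ?ler0n.
  apply: le_trans (_ : (25 * m ^ 4)%N%:R <= _).
    by rewrite ler_nat triangle_types_upper.
  have m2 : m%:R <= 2 * n%:R `^ 3^-1 :> R.
    rewrite -(@ler_pXn2r _ 3) ?nnegrE ?mulr_ge0 ?powR_ge0 //.
    rewrite exprMn powR_exp mulVf ?pnatr_eq0 // powRr1 // -!natrX -natrM ler_nat.
    exact: mn.
  rewrite natrM natrX -mulrA.
  rewrite ler_wpM2l ?ler0n // [4 / 3]mulrC -powR_exp -exprMn.
  by rewrite lerXn2r ?nnegrE ?mulr_ge0 ?powR_ge0 ?ler0n.
- apply: (@eqOmega_nat _ _ _ 21 4) => // n n4.
  rewrite !ger0_norm ?powR_ge0 // -natrM.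
  (* Cubing turns the exponent 4/3 into 4 and leaves an inequality between integers. *)
  rewrite -(@ler_pXn2r _ 3) ?nnegrE ?powR_ge0 // powR_exp divfK ?pnatr_eq0 //.
  by rewrite powR_mulrn // -!natrX ler_nat min_triangle_types_lower.
Qed.
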